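(* Let $\alpha,\gamma,\mu>0$. For the two-customer game with index costs, no closing time, and no early birds (only arrival times $t\ge 0$ are allowed), the symmetric equilibrium arrival distribution is given by the following, where $p_0$ is the probability of arriving at time zero: 1. If $\frac{\alpha}{\mu}\le\gamma$ then $p_0=1$, i.e. both customers arrive at time zero and are admitted into service in random order. The expected cost for each customer is $\frac12\left(\frac{\alpha}{\mu}+\gamma\right)$. 2. If $\frac{\alpha}{\mu}>\gamma$ then $p_0=\frac{2\gamma}{\gamma+\frac{\alpha}{\mu}}$ and the distribution on $(0,\infty)$ has density $$f(t)=(1-p_0)\frac{\mu}{2}p_0\,e^{-\frac{\mu}{2}p_0(t-t^e)}\,\mathbf{1}_{\{t\ge t^e\}},$$ where $t^e=-\frac{1}{\mu}\log\left(\frac12\left(1-\frac{\gamma\mu}{\alpha}\right)\right)$. The expected cost for each customer is $\gamma$.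
   Context: Model. There are two customers, each choosing (possibly at random, independently) an arrival time $t\ge 0$. A single server starts operating at time $0$ and serves First Come First Served; service times are i.i.d. exponential with rate $\mu$. Customers arriving at exactly the same time are admitted in uniformly random order. Each customer pays $\alpha$ per unit of time from arrival until admission into service, and $\gamma$ if the other customer is ahead of him in the arrival order. When the other customer arrives according to a cdf $F$, the expected cost of arriving at $t\ge0$ is $$c_F(t)=\frac{\alpha}{\mu}\mathbb{E}Q_F(t)+\gamma\,\mathbb{E}A_F(t),$$ where $A_F(t)\in\{0,1\}$ indicates whether the other customer has arrived up to time $t$ and $Q_F(t)\in\{0,1\}$ whether he is present in the system at time $t$; if $F$ has an atom at $t$, a simultaneous arrival counts only if placed ahead by the random tie-breaking (so $c_F(0)=\frac{p_0}{2}(\frac{\alpha}{\mu}+\gamma)$ with $p_0=F(0)$). A symmetric equilibrium arrival distribution is a cdf $F$ for which there is a constant $c_e$ (the equilibrium cost) such that $c_F(t)=c_e$ for all $t$ in the support of $F$ and $c_F(t)\ge c_e$ for every admissible $t$. Only distributions $F$ whose support is, on any finite interval, a finite union of closed intervals and points are considered. *)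

(* Defs.v *)
From HB Require Import structures.
From mathcomp Require Import all_boot all_order all_algebra.
From mathcomp Require Import all_classical all_reals all_analysis.

Set Implicit Arguments.
Unset Strict Implicit.
Unset Printing Implicit Defensive.
Import Order.TTheory GRing.Theory Num.Theory.
Import numFieldNormedType.Exports.

Local Open Scope classical_set_scope.
Local Open Scope ring_scope.

Notation cdf_type R := (cumulativeBounded (0 : R) (1 : R)).

Section game.
Context {R : realType}.

(* A customer arrives at t.  The other one arrives at x >= 0, has service time
   s, and wins a tie iff b holds. *)
Definition ahead (t x : R) (b : bool) : bool := (x < t) || (x == t) && b.

(* When ahead, the other customer starts service on arrival (the server is free
   and open, as x >= 0), hence leaves at x + s. *)
Definition present (t x s : R) (b : bool) : bool :=
  ahead t x b && (t < x + s).

Variables (alpha gamma mu : R) (F : cdf_type R).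

(* Arrival time ~ F, service time ~ Exp(mu) and fair tie-breaking coin are
   independent, so the expectation is an iterated integral. *)
Definition expect (g : R -> R -> bool -> bool) : \bar R :=
  (\int[lebesgue_stieltjes_measure F]_x
    \int[exponential_prob mu]_s
      \int[bernoulli_prob (2^-1 : R)]_b ((g x s b)%:R : R)%:E)%E.

Definition EQ (t : R) : \bar R := expect (present t).

Definition EA (t : R) : \bar R := expect (fun x _ b => ahead t x b).

Definition cost (t : R) : \bar R :=
  ((alpha / mu)%:E * EQ t + gamma%:E * EA t)%E.

Definition cdf_support : set R :=
  [set t | forall U : set R, open U -> U t ->
     (0 < lebesgue_stieltjes_measure F U)%E].

(* Isolated points are degenerate intervals [x, x]. *)
Definition locally_finite_union_of_intervals (S : set R) : Prop :=
  forall a b : R, exists s : seq (R * R),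
    S `&` `[a, b]%classic =
      \bigcup_(p in [set` s]) `[p.1, p.2]%classic.

Definition no_early_birds : Prop := forall t : R, t < 0 -> F t = 0.

Definition symmetric_equilibrium (c : R) : Prop :=
  [/\ no_early_birds,
      locally_finite_union_of_intervals cdf_support,
      forall t, cdf_support t -> cost t = c%:E &
      forall t, 0 <= t -> (c%:E <= cost t)%E].

End game.

Definition the_symmetric_equilibrium {R : realType} (alpha gamma mu : R)
    (F : cdf_type R) (c : R) : Prop :=
  symmetric_equilibrium alpha gamma mu F c /\
  forall (G : cdf_type R) (c' : R),
    symmetric_equilibrium alpha gamma mu G c' -> G =1 F /\ c' = c.

Definition has_density_on {R : realType} (F : cdf_type R) (D : set R)
    (f : R -> R) : Prop :=
  forall A : set (measurableTypeR R), measurable A -> A `<=` D ->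
    lebesgue_stieltjes_measure F A =
    (\int[@lebesgue_measure R]_(t in A) (f t)%:E)%E.

(* Main.v *)
(** Write [a = alpha / mu] and let [weight mu t] be the integral of [e^(mu x)]
    over [x <= t] against the Stieltjes measure of [F], so that at a time [t]
    without atom the cost is [a e^(-mu t) weight mu t + gamma F t].  All that is
    used about [weight] is that its increment over [`]u, v]] lies between
    [e^(mu u)] and [e^(mu v)] times the increment of [F].

    In an equilibrium [F]: arriving just before an atom at [t > 0] is cheaper
    than arriving at [t], so [0] is the only atom; letting [t] tend to infinity
    gives [c <= gamma], and if [F 0 < 1] then arbitrarily high quantiles of [F]
    lie in the support, whence [c = gamma].  Comparing with the cost at [0] fixes
    [F 0].  While nobody arrives the cost decreases, so once it has come down to
    [gamma], at [te], it stays equal to [gamma]; this linear equation determines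
    [F] on [`[te, +oo[].  Both the uniqueness for that equation and the cost of
    the explicit solution come from bounding increments to second order, without
    integration by parts. *)

Require Import Defs.
From HB Require Import structures.
From mathcomp Require Import all_boot all_order all_algebra.
From mathcomp Require Import all_classical all_reals all_analysis.
From mathcomp Require Import ring lra measurable_realfun.
Set Implicit Arguments.
Unset Strict Implicit.
Unset Printing Implicit Defensive.
Import Order.TTheory GRing.Theory Num.Theory.
Import numFieldNormedType.Exports.
Local Open Scope classical_set_scope.
Local Open Scope ring_scope.

(** * Stieltjes measure of an arrival cdf: atoms and exponential weights *)

Section stieltjes.
Context {R : realType} (F : cdf_type R).
Local Notation m := (lebesgue_stieltjes_measure F).

Lemma stieltjes_itvoc (s t : R) : s <= t -> m `]s, t] = (F t - F s)%:E.
Proof.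
move=> st; rewrite /lebesgue_stieltjes_measure /measure_extension/=.
by rewrite measurable_mu_extE/= ?wlength_itv_bnd//; exact: is_ocitv.
Qed.

Lemma stieltjes_itvNyc (t : R) : m `]-oo, t] = (F t)%:E.
Proof. by rewrite -cdf_lebesgue_stieltjes_id. Qed.

Lemma cdf_homo (s t : R) : s <= t -> F s <= F t.
Proof. exact: cumulative_is_nondecreasing. Qed.

Lemma cdf_ge0 (t : R) : 0 <= F t.
Proof. by rewrite -lee_fin -stieltjes_itvNyc measure_ge0. Qed.

Lemma cdf_le1 (t : R) : F t <= 1.
Proof. by rewrite -lee_fin -stieltjes_itvNyc probability_le1. Qed.

Lemma cdf_near1 (e : R) : 0 < e -> exists2 t, 0 < t & 1 - e < F t.
Proof.
move=> e0; have /cvgrPdist_lt/(_ e e0) := cumulativey F.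
move=> [M [Mr HM]]; exists (Num.max M 0 + 1).
  by rewrite ltr_wpDl// le_max lexx orbT.
have /HM : M < Num.max M 0 + 1 by rewrite ltr_pwDr// le_max lexx.
by rewrite /= ltr_norml => /andP[_ ]; lra.
Qed.

Definition atom (t : R) : R := fine (m [set t]).

Lemma atomE (t : R) : m [set t] = (atom t)%:E.
Proof. by rewrite /atom fineK// fin_num_measure. Qed.

Lemma atom_ge0 (t : R) : 0 <= atom t.
Proof. by rewrite -lee_fin -atomE measure_ge0. Qed.

Lemma atom_le (s t : R) : s < t -> atom t <= F t - F s.
Proof.
move=> st; rewrite -lee_fin -atomE -stieltjes_itvoc ?(ltW st)//.
by apply: le_measure; rewrite ?inE// => x /= ->; rewrite in_itv/= st/=.
Qed.

(** [F 0] is the mass of []-oo, 0]], and []-oo, 0[] is null: it is the countable union of the rays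
    []-oo, - n.+1%:R^-1]], whose masses are values of [F] at negative times. *)
Lemma atom0 : no_early_birds F -> atom 0 = F 0.
Proof.
move=> F0; apply/EFin_inj; rewrite -atomE -stieltjes_itvNyc.
have -> : `]-oo, 0]%classic = `]-oo, 0[ `|` [set 0] :> set R.
  by rewrite setUitv1.
rewrite measureU//; last first.
  by apply/seteqP; split => x//= [/[swap] ->]; rewrite in_itv/= ltxx.
rewrite [X in (X + _)%E](_ : _ = 0%E) ?add0e//.
apply/eqP; rewrite eq_le measure_ge0 andbT.
rewrite (_ : `]-oo, 0[%classic = \bigcup_n `]-oo, - n.+1%:R^-1]%classic).
  have mI n : measurable (`]-oo, - n.+1%:R^-1]%classic : set (measurableTypeR R)).
    exact: measurable_itv.
  have /le_trans := @measure_sigma_subadditive _ _ _ m _ _ mI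
    (bigcupT_measurable _ mI) (@subset_refl _ _).
  apply.
  by rewrite eseries0// => n _ _; rewrite [LHS]stieltjes_itvNyc F0// oppr_lt0.
apply/seteqP; split => x /=; rewrite in_itv/=.
  move=> /ltr_add_invr[n nx].
  by exists n => //=; rewrite in_itv/= ltW// -[ltRHS]sub0r ltrBrDr.
by case=> n _ /=; rewrite in_itv/= => /le_lt_trans; apply; rewrite oppr_lt0.
Qed.


Lemma measurable_expRM (mu : R) (D : set (measurableTypeR R)) :
  measurable_fun D (EFin \o (fun x : measurableTypeR R => expR (mu * x))).
Proof.
apply/measurable_EFinP/measurable_funTS.
by apply: measurableT_comp => //; exact: measurable_funM.
Qed.

Lemma integral_expR_itvoc_bounds (mu s t : R) : 0 < mu -> s <= t ->
  ((expR (mu * s) * (F t - F s))%:E <=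
   \int[m]_(x in `]s, t]) (expR (mu * x))%:E <=
   (expR (mu * t) * (F t - F s))%:E)%E.
Proof.
move=> mu0 st; rewrite !EFinM -(stieltjes_itvoc st).
have mD : measurable (`]s, t]%classic : set (measurableTypeR R)).
  exact: measurable_itv.
rewrite -!(integral_cst _ mD); apply/andP; split; apply: ge0_le_integral => //.
- by move=> x _ /=; rewrite lee_fin expR_ge0.
- exact: measurable_expRM.
- move=> x /=; rewrite in_itv/= => /andP[sx _].
  by rewrite lee_fin ler_expR ler_pM2l// ltW.
- exact: measurable_expRM.
- move=> x /=; rewrite in_itv/= => /andP[_ xt].
  by rewrite lee_fin ler_expR ler_pM2l.
Qed.

Lemma integral_expR_itvNyc_le (mu t : R) : 0 < mu ->
  (\int[m]_(x in `]-oo, t]) (expR (mu * x))%:E <= (expR (mu * t) * F t)%:E)%E.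
Proof.
move=> mu0; rewrite EFinM -stieltjes_itvNyc.
have mD : measurable (`]-oo, t]%classic : set (measurableTypeR R)).
  exact: measurable_itv.
rewrite -(integral_cst _ mD); apply: ge0_le_integral => //.
- exact: measurable_expRM.
- move=> x /=; rewrite in_itv/= => xt.
  by rewrite lee_fin ler_expR ler_pM2l.
Qed.

Definition weight (mu t : R) : R :=
  fine (\int[m]_(x in `]-oo, t]) (expR (mu * x))%:E)%E.

Lemma integral_expR_itvNyc (mu t : R) : 0 < mu ->
  (\int[m]_(x in `]-oo, t]) (expR (mu * x))%:E = (weight mu t)%:E)%E.
Proof.
move=> mu0; rewrite /weight fineK// ge0_fin_numE; last first.
  by apply: integral_ge0 => x _; rewrite lee_fin expR_ge0.
by rewrite (le_lt_trans (integral_expR_itvNyc_le _ mu0))// ltry.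
Qed.

Lemma weight_le (mu t : R) : 0 < mu -> weight mu t <= expR (mu * t) * F t.
Proof.
by move=> mu0; rewrite -lee_fin -integral_expR_itvNyc ?integral_expR_itvNyc_le.
Qed.

Lemma weight_ge0 (mu t : R) : 0 <= weight mu t.
Proof.
by apply: fine_ge0; apply: integral_ge0 => x _; rewrite lee_fin expR_ge0.
Qed.

Lemma weight_incr (mu s t : R) : 0 < mu -> s <= t ->
  expR (mu * s) * (F t - F s) <= weight mu t - weight mu s
    <= expR (mu * t) * (F t - F s).
Proof.
move=> mu0 st; rewrite -!lee_fin EFinB -!integral_expR_itvNyc//.
have -> : `]-oo, t]%classic = `]-oo, s] `|` `]s, t] :> set R.
  by rewrite -itv_bndbnd_setU.
rewrite ge0_integral_setU//=.
- rewrite addeAC subee ?add0e ?integral_expR_itvNyc//.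
  exact: integral_expR_itvoc_bounds.
- exact: measurable_expRM.
- apply/disj_setPRL => x /=; rewrite !in_itv/= => /andP[sx _].
  by apply/negP; rewrite -ltNge.
Qed.

(** All the mass up to 0 sits at 0, where the factor is [expR 0 = 1]. The lower bound comes from
    [weight_incr] started at a slightly negative time, where [F] vanishes. *)
Lemma weight0 (mu : R) : 0 < mu -> no_early_birds F -> weight mu 0 = F 0.
Proof.
move=> mu0 F0.
have upper t : weight mu t <= expR (mu * t) * F t by exact: weight_le.
have := upper 0; rewrite mulr0 expR0 mul1r => W0.
apply/eqP; rewrite eq_le W0/= leNgt; apply/negP => WF.
(* With [delta = F 0 - weight mu 0], this makes [expR (mu * s) >= 1 - delta / 2]. As [F 0 <= 1], the
   weight gained over []s, 0]] is at least [F 0 - delta / 2], which exceeds [weight mu 0]. *)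
pose s := - ((F 0 - weight mu 0) / (2 * mu)).
have mus : mu * s = - ((F 0 - weight mu 0) / 2).
  by rewrite /s; field; rewrite gt_eqF.
have s0 : s < 0 by rewrite -(pmulr_rlt0 _ mu0) mus; lra.
have /andP[+ _] := weight_incr mu0 (ltW s0).
rewrite (F0 s s0) subr0 mus => Ws.
have := expR_ge1Dx (- ((F 0 - weight mu 0) / 2)).
have := weight_ge0 mu s; have := cdf_le1 0; have := cdf_ge0 0.
set e := expR _ in Ws *; nra.
Qed.

End stieltjes.

(** * Closed form of the expected cost *)

Lemma exponential_prob_itvoy {R : realType} (mu y : R) : 0 < mu -> 0 <= y ->
  exponential_prob mu `]y, +oo[ = (expR (- mu * y))%:E.
Proof.
move=> mu0 y0; rewrite /exponential_prob integral_itv_obnd_cbnd; last first.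
  by apply/measurable_EFinP/measurable_funTS; exact: measurable_exponential_pdf.
have cexp : continuous (fun z : R => - expR (- mu * z)).
  move=> z; apply: cvgN; apply: continuous_comp; last exact: continuous_expR.
  exact: mulrl_continuous.
rewrite (@ge0_continuous_FTC2y _ _ (fun x => - expR (- mu * x)) _ 0)//.
- by rewrite EFinN oppeK add0e.
- by move=> x _; apply: exponential_pdf_ge0; exact: ltW.
- apply: continuous_subspaceW; last exact: within_continuous_exponential_pdf.
  by apply: subset_itvr; rewrite bnd_simp.
- rewrite -oppr0; apply: cvgN.
  rewrite (_ : (fun x => expR (- mu * x)) =
               (fun z => expR (- z)) \o (fun z => mu * z)); last first.
    by apply: eq_fun => x; rewrite mulNr.
  apply: (@cvg_comp _ _ _ _ _ _ (pinfty_nbhs R)); last exact: cvgr_expR.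
  exact: gt0_cvgMry.
- by apply/cvg_at_right_filter; exact: cexp.
- move=> z; rewrite in_itv/= andbT => yz.
  by apply: derive1_exponential_pdf; rewrite in_itv/= andbT (le_lt_trans y0).
Qed.

Section cost.
Context {R : realType} (F : cdf_type R).
Local Notation m := (lebesgue_stieltjes_measure F).

Lemma integral_ahead (t x : R) :
  (\int[bernoulli_prob (2^-1 : R)]_b ((ahead t x b)%:R : R)%:E =
   ((x < t)%R%:R + (x == t)%:R / 2)%R%:E)%E.
Proof.
rewrite integral_bernoulli_prob; last 2 first.
- by lra.
- by move=> b; rewrite lee_fin ler0n.
rewrite /ahead andbT andbF orbF -!EFinM -EFinD.
rewrite /unstable.onem; case: ltgtP => _ /=; congr EFin; lra.
Qed.

(** For [x <= t] the service outlasts [t - x] with probability [expR (- (mu * (t - x)))]. It is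
    written as a product so that the factor in [t] can leave the integral over [x]. *)
Lemma integral_present (mu t x : R) : 0 < mu ->
  (\int[exponential_prob mu]_s
    \int[bernoulli_prob (2^-1 : R)]_b ((present t x s b)%:R : R)%:E =
   (expR (- (mu * t)) * expR (mu * x) * ((x < t)%R%:R + (x == t)%:R / 2))%R%:E)%E.
Proof.
move=> mu0; have [xt|tx] := leP x t; last first.
  rewrite gt_eqF// ltNge (ltW tx)/= mul0r addr0 mulr0.
  under eq_integral do under eq_integral do
    rewrite /present /ahead ltNge (ltW tx) gt_eqF//=.
  by under eq_integral do rewrite integral0; rewrite integral0.
have E s : (\int[bernoulli_prob (2^-1 : R)]_b ((present t x s b)%:R : R)%:E =
    ((x < t)%R%:R + (x == t)%:R / 2)%R%:E * (\1_(`]t - x, +oo[%classic : set R) s)%:E)%E.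
  rewrite indicE mem_setE in_itv/= andbT ltrBlDl; case: (ltP t (x + s)) => ts.
    rewrite mule1 -integral_ahead.
    by apply: eq_integral => b _; rewrite /present ts andbT.
  rewrite mule0 -[RHS](integral0 (bernoulli_prob (2^-1 : R)) setT).
  by apply: eq_integral => b _; rewrite /present ltNge ts andbF.
under eq_integral do rewrite E.
rewrite ge0_integralZl//=.
- rewrite integral_indic// setIT [X in (_ * X)%E](exponential_prob_itvoy mu0) ?subr_ge0//.
  rewrite -EFinM; congr EFin; rewrite -expRD mulrC; congr (expR _ * _); ring.
- by apply/measurable_EFinP; exact: measurable_indic.
Qed.


(** A tie counts one half, so half of the atom at [t] is missing from the integral over []-oo, t]].
    Adding it on the left avoids a subtraction in [\bar R]. *)
Lemma integral_half_tie (w : measurableTypeR R -> R) (t : R) :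
  measurable_fun setT w -> (forall x, 0 <= w x) ->
  (\int[m]_x (w x * ((x < t)%R%:R + (x == t)%:R / 2))%R%:E
     + (w t / 2 * atom F t)%:E = \int[m]_(x in `]-oo, t]) (w x)%:E)%E.
Proof.
move=> mw w0.
have mt : measurable ([set t] : set (measurableTypeR R)) by exact: measurable_set1.
have -> : (w t / 2 * atom F t)%:E = (\int[m]_x (w t / 2 * \1_[set t] x)%:E)%E.
  under eq_integral do rewrite EFinM.
  rewrite ge0_integralZl//=.
  - by rewrite integral_indic// setIT EFinM -atomE.
  - by apply/measurable_EFinP; exact: measurable_indic.
  - by rewrite lee_fin divr_ge0.
rewrite -ge0_integralD//=.
- rewrite [RHS]integral_mkcond; apply: eq_integral => x _.
  rewrite patchE mem_setE in_itv/= indicE -EFinD.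
  rewrite (_ : (x \in [set t]) = (x == t)); last first.
    by apply/idP/eqP => [/set_mem|->]//; apply/mem_set.
  case: ltgtP => [xt|xt|->] /=; congr EFin; lra.
- by move=> x _; rewrite lee_fin mulr_ge0//; case: ltgtP => _ /=; lra.
- rewrite (_ : (fun x => _) = (EFin \o (w \* (\1_(`]-oo, t[%classic : set R) \+
     (cst (2^-1) \* \1_[set t])))))%R.
    apply/measurable_EFinP; apply: measurable_funM => //.
    apply: measurable_funD; first exact: measurable_indic.
    by apply: measurable_funM => //; exact: measurable_indic.
  apply/funext => x /=; rewrite !indicE mem_setE in_itv/= mulrC.
  rewrite (_ : (x \in [set t]) = (x == t)); last first.
    by apply/idP/eqP => [/set_mem|->]//; apply/mem_set.
  by rewrite mulrC [_ / 2]mulrC.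
- by move=> x _; rewrite lee_fin mulr_ge0// divr_ge0.
- by apply/measurable_EFinP; exact: measurable_funM.
Qed.

Lemma EQE (mu t : R) : 0 < mu ->
  EQ mu F t = (expR (- (mu * t)) * weight F mu t - atom F t / 2)%:E.
Proof.
move=> mu0; rewrite /EQ /expect.
under eq_integral do rewrite integral_present//.
have mw : measurable_fun setT
    (fun x : measurableTypeR R => expR (- (mu * t)) * expR (mu * x)).
  apply: measurable_funM => //; apply/measurable_EFinP.
  exact: measurable_expRM.
have w0 x : 0 <= expR (- (mu * t)) * expR (mu * x).
  by rewrite mulr_ge0 ?expR_ge0.
have := integral_half_tie t mw w0.
(* At [x = t] the survival factor is 1, so the tie correction is just [atom F t / 2]. *)
rewrite -expRD addNr expR0.
under [X in _ = X -> _]eq_integral do rewrite EFinM.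
rewrite ge0_integralZl_EFin ?expR_ge0//; last exact: measurable_expRM.
rewrite integral_expR_itvNyc// -EFinM => E.
by rewrite EFinB -E mul1r [2^-1 * _]mulrC addeK.
Qed.

Lemma EAE (mu t : R) : 0 < mu -> EA mu F t = (F t - atom F t / 2)%:E.
Proof.
move=> mu0; rewrite /EA /expect.
have inner x : (\int[exponential_prob mu]_s
    \int[bernoulli_prob (2^-1 : R)]_b ((ahead t x b)%:R : R)%:E =
    (1 * ((x < t)%R%:R + (x == t)%:R / 2))%R%:E)%E.
  under eq_integral do rewrite integral_ahead.
  rewrite (integral_cst (exponential_prob mu)) ?mul1r//.
  by rewrite [X in (_ * X)%E](@probability_setT _ _ _ (exponential_prob mu)) ?mule1.
under eq_integral do rewrite inner.
have := @integral_half_tie (cst 1) t (measurable_cst _) (fun=> ler01).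
have mD : measurable (`]-oo, t]%classic : set (measurableTypeR R)).
  exact: measurable_itv.
rewrite /= [RHS](integral_cst _ mD) [X in _ = (_ * X)%E -> _]stieltjes_itvNyc mul1e => E.
by rewrite EFinB -E mul1r [2^-1 * _]mulrC addeK.
Qed.

Lemma costE (alpha gamma mu t : R) : 0 < mu ->
  cost alpha gamma mu F t = (alpha / mu * (expR (- (mu * t)) * weight F mu t)
    + gamma * F t - (alpha / mu + gamma) * atom F t / 2)%:E.
Proof.
move=> mu0; rewrite /cost EQE// EAE// -!EFinM -EFinD; congr EFin; ring.
Qed.

End cost.

(* [D] cannot increase, since cutting [`[s, t]] into [n] pieces bounds its increase
   by [C (t - s) (B t - B s) / n]. *)
Lemma le_of_small_increments {R : realType} (D B : R -> R) (C s t : R) :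
  s <= t ->
  (forall u v, s <= u -> u <= v -> v <= t ->
    D v - D u <= C * (v - u) * (B v - B u)) ->
  D t <= D s.
Proof.
move=> st H; rewrite leNgt; apply/negP => Dst.
pose M := C * (t - s) * (B t - B s).
have key (n : nat) : D t - D s <= M / n.+1%:R.
  pose h := (t - s) / n.+1%:R; pose u (i : nat) := s + i%:R * h.
  have h0 : 0 <= h by rewrite divr_ge0 ?subr_ge0.
  have uN : u n.+1 = t by rewrite /u /h mulrC divfK ?pnatr_eq0//; ring.
  have u0 : u 0%N = s by rewrite /u mul0r addr0.
  have uS i : u i.+1 = u i + h by rewrite /u -natr1; ring.
  (* All pieces share the length [h], so the increments of [B] telescope. *)
  have step i : (i <= n.+1)%N -> D (u i) - D s <= C * h * (B (u i) - B s).
    elim: i => [_|i IH iN]; first by rewrite u0 !subrr mulr0.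
    have := H (u i) (u i.+1); rewrite uS [_ + h - _]addrAC subrr add0r.
    have si : s <= u i by rewrite lerDl mulr_ge0.
    have it : u i + h <= t.
      by rewrite -uS -uN /u lerD2l ler_wpM2r// ler_nat.
    have ii : u i <= u i + h by rewrite lerDl.
    move=> /(_ si ii it) Hi; have := IH (ltnW iN); lra.
  have := step n.+1 (leqnn _); rewrite uN.
  suff -> : C * h * (B t - B s) = M / n.+1%:R by [].
  by rewrite /M /h; ring.
have d0 : 0 < D t - D s by rewrite subr_gt0.
have [n Hn] : exists n : nat, M / n.+1%:R < D t - D s.
  (* The sign of [M] is unknown, hence the absolute value. *)
  exists (Num.truncn (`|M| / (D t - D s))).
  rewrite ltr_pdivrMr// mulrC -ltr_pdivrMr//.
  apply: le_lt_trans (truncnS_gt _).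
  by rewrite ler_pM2r ?invr_gt0// ler_norm.
by have := key n; rewrite leNgt Hn.
Qed.

(** * Points of the support, quantiles, and two elementary inequalities *)

Section support.
Context {R : realType} (F : cdf_type R).
Local Notation m := (lebesgue_stieltjes_measure F).

Lemma stieltjes_open_gt0 (U : set R) (s t : R) : open U -> `]s, t] `<=` U ->
  F s < F t -> (0 < m U)%E.
Proof.
move=> oU sU st.
have mU : measurable (U : set (measurableTypeR R)) by exact: open_measurable.
have lest : s <= t.
  by rewrite leNgt; apply/negP => /ltW/(cdf_homo F); rewrite leNgt st.
apply: (@lt_le_trans _ _ (m `]s, t])).
  by rewrite stieltjes_itvoc// lte_fin subr_gt0.
by apply: le_measure => //; rewrite inE//; exact: measurable_itv.
Qed.

Lemma support_left (t : R) : (forall s, s < t -> F s < F t) -> cdf_support F t.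
Proof.
move=> H U oU Ut.
have /nbhs_ballP[e /= e0 eU] := open_nbhs_nbhs (conj oU Ut).
apply: (@stieltjes_open_gt0 U (t - e) t) => //; last by apply: H; rewrite gtrBl.
move=> x /=; rewrite in_itv/= => /andP[tx xt]; apply: eU.
by rewrite /ball/= ger0_norm ?subr_ge0// ltrBlDl -ltrBlDr.
Qed.

Lemma support_right (t : R) : (forall s, t < s -> F t < F s) -> cdf_support F t.
Proof.
move=> H U oU Ut.
have /nbhs_ballP[e /= e0 eU] := open_nbhs_nbhs (conj oU Ut).
apply: (@stieltjes_open_gt0 U t (t + e / 2)) => //; last first.
  by apply: H; rewrite ltrDl divr_gt0.
move=> x /=; rewrite in_itv/= => /andP[tx xt]; apply: eU.
rewrite /ball/= distrC ger0_norm; lra.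
Qed.

Lemma support_atom (t : R) : 0 < atom F t -> cdf_support F t.
Proof.
by move=> t0; apply: support_left => s /(atom_le F); rewrite -subr_gt0; apply: lt_le_trans.
Qed.

Lemma support_flat (a t b : R) : a < t -> t < b -> F a = F b ->
  ~ cdf_support F t.
Proof.
move=> at_ tb Fab /(_ `]a, b[%classic (interval_open _ _)).
rewrite /= in_itv/= at_ tb => /(_ isT isT isT); apply/negP; rewrite -leNgt.
have -> : 0%E = m `]a, b].
  by rewrite stieltjes_itvoc ?Fab ?subrr// ltW// (lt_trans at_).
apply: le_measure; rewrite ?inE; [exact: measurable_itv..|].
by apply: subset_itvl; rewrite bnd_simp.
Qed.

(** Take [q] as the infimum of the times [s] with [y <= F s]. Right continuity gives [y <= F q];
    minimality gives [F s < F q] for [s < q], so [q] is in the support. This supplies the points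
    where an equilibrium cost is exactly [c]. *)
Lemma quantile (y a b : R) : F a < y -> y <= F b ->
  exists q, [/\ cdf_support F q, y <= F q & forall s, y <= F s -> q <= s].
Proof.
move=> Fa Fb; pose S := [set s | y <= F s].
have lbS : lbound S a.
  move=> s /= ys; rewrite leNgt; apply/negP => /ltW/(cdf_homo F).
  by rewrite leNgt (lt_le_trans Fa).
have iS : has_inf S by split; [exists b|exists a].
have qS s : y <= F s -> inf S <= s by move=> ys; apply: ge_inf; [exists a|].
have yq : y <= F (inf S).
  apply/ler_addgt0Pr => e e0.
  have [d Hd] := nondecreasing_right_continuousP (inf S) F e0.
  have [s ys sd] := inf_adherent (gt0 d) iS.
  by rewrite (le_trans ys)// (le_trans _ Hd)// cdf_homo// ltW.
exists (inf S); split=> //; apply: support_left => s sq.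
by apply: lt_le_trans yq; rewrite ltNge; apply/negP => /qS; rewrite leNgt sq.
Qed.

End support.

Lemma le0_of_le_small {R : realFieldType} (A B t : R) : 0 < t ->
  (forall d, 0 < d -> d <= t -> A <= B * d) -> A <= 0.
Proof.
move=> t0 H; rewrite leNgt; apply/negP => A0.
have b0 : 0 < `|B| + 1 by rewrite ltr_wpDl.
pose d := Num.min t (A / (`|B| + 1)).
have d0 : 0 < d by rewrite lt_min t0 divr_gt0.
have dA : d * (`|B| + 1) <= A by rewrite -ler_pdivlMr// ge_min lexx orbT.
have := H d d0; rewrite ge_min lexx => /(_ isT).
have := ler_norm B; nra.
Qed.

(** By convexity, [expR] lies above its tangent at [y]. Since [x] and [y] come in either order,
    swapping them gives both upper and lower bounds on an increment. *)
Lemma expR_diff_le {R : realType} (x y : R) :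
  expR y - expR x <= (y - x) * expR y.
Proof.
have := expR_ge1Dx (x - y).
have -> : expR x = expR y * expR (x - y) by rewrite -expRD addrC subrK.
have := expR_gt0 y; nra.
Qed.

(* The cost of arriving at a time without atom; [a] stands for [alpha / mu]. *)
Definition smooth_cost {R : realType} (a gamma mu : R) (F : cdf_type R) (t : R) :=
  a * (expR (- (mu * t)) * weight F mu t) + gamma * F t.

(** * Necessary conditions on an equilibrium *)

Section equilibrium.
Context {R : realType} (alpha gamma mu : R).
Hypotheses (alpha_gt0 : 0 < alpha) (gamma_gt0 : 0 < gamma) (mu_gt0 : 0 < mu).
Let a := alpha / mu.
Let a_gt0 : 0 < a. Proof. exact: divr_gt0. Qed.
Variables (F : cdf_type R) (c : R).
Hypothesis eqF : symmetric_equilibrium alpha gamma mu F c.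
Local Notation phi := (smooth_cost a gamma mu F).

Let F_lt0 : no_early_birds F. Proof. by case: eqF. Qed.

Lemma equilibrium_le t : 0 <= t ->
  c <= phi t - (a + gamma) * atom F t / 2.
Proof. by case: eqF => _ _ _ H /H; rewrite costE. Qed.

Lemma equilibrium_eq t : cdf_support F t ->
  c = phi t - (a + gamma) * atom F t / 2.
Proof. by case: eqF => _ _ H _ /H; rewrite costE// => -[]. Qed.

(* Arriving shortly before an atom avoids the ties at a vanishing extra wait. *)
Lemma equilibrium_atom t : 0 < t -> atom F t = 0.
Proof.
move=> t0; apply/eqP; rewrite eq_le atom_ge0 andbT leNgt; apply/negP => j0.
have ct := equilibrium_eq (support_atom j0).
suff : (a + gamma) * atom F t / 2 <= 0.
  by rewrite leNgt mulr_gt0// mulr_gt0// addr_gt0.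
(* Arriving [d] earlier changes the survival factor by at most [mu * d], hence the cost by at most
   [a * weight F mu t * mu * d], while the gain from avoiding the tie does not shrink with [d]. *)
apply: (@le0_of_le_small _ _ (a * weight F mu t * mu) t t0) => d d0 dt.
have s0 : 0 <= t - d by rewrite subr_ge0.
have st : t - d < t by rewrite gtrBl.
have := equilibrium_le s0; rewrite ct /smooth_cost.
have /andP[+ _] := weight_incr F mu_gt0 (ltW st).
have := atom_le F st; have := atom_ge0 F (t - d).
have := weight_ge0 F mu t.
have := expR_diff_le (- (mu * t)) (- (mu * (t - d))).
have : expR (- (mu * (t - d))) <= 1.
  by rewrite expR_le1 oppr_le0 mulr_ge0// ltW.
have := expRxMexpNx_1 (mu * (t - d)).
have := expR_gt0 (- (mu * (t - d))).
have := expR_gt0 (mu * (t - d)).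
have -> : - (mu * (t - d)) - - (mu * t) = mu * d by ring.
set es := expR (- (mu * (t - d))); set Es := expR (mu * _).
set et := expR _; set W := weight F mu t; set Ws := weight F mu _.
set j := atom F t; set js := atom F _.
move=> Es0 es0 EesE es1 ed W0 js0 jF wi le.
(* The atom lies in []t - d, t]] and contributes at least [Es * j] to the weight; then
   [Es * es = 1]. *)
have h1 : es * Ws <= es * W - j.
  have : es * (Es * j) <= es * (W - Ws).
    rewrite ler_pM2l//; apply: le_trans wi; rewrite ler_pM2l//.
  by rewrite mulrA [es * Es]mulrC EesE; lra.
have h2 : es * W <= et * W + mu * d * W.
  rewrite -mulrDl ler_wpM2r//.
  have : mu * d * es <= mu * d by rewrite ler_piMr// mulr_ge0// ltW.
  lra.
have h3 : a * (es * Ws) <= a * (et * W + mu * d * W - j).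
  by rewrite ler_pM2l//; lra.
have h4 : gamma * F (t - d) <= gamma * (F t - j).
  by rewrite ler_pM2l//; lra.
have h5 : 0 <= (a + gamma) * js.
  by rewrite mulr_ge0// ltW// addr_gt0.
lra.
Qed.

Lemma equilibrium_gt0_le t : 0 < t -> c <= phi t.
Proof.
by move=> t0; have := equilibrium_le (ltW t0); rewrite equilibrium_atom// mulr0 mul0r subr0.
Qed.

Lemma equilibrium_gt0_eq t : 0 < t -> cdf_support F t -> c = phi t.
Proof.
by move=> t0 /equilibrium_eq; rewrite equilibrium_atom// mulr0 mul0r subr0.
Qed.

Lemma equilibrium_at0_le : c <= (a + gamma) * F 0 / 2.
Proof.
have := equilibrium_le (lexx 0).
rewrite /smooth_cost weight0// atom0// mulr0 oppr0 expR0; lra.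
Qed.

Lemma smooth_cost_ge t : gamma * F t <= phi t.
Proof.
by rewrite /smooth_cost lerDr mulr_ge0 ?(ltW a_gt0)// mulr_ge0 ?expR_ge0 ?weight_ge0.
Qed.

(** At a support point [q > 0] with [y <= F q], the index part of the cost alone is
    [gamma * F q]. *)
Lemma equilibrium_quantile y : F 0 < y -> y < 1 -> gamma * y <= c.
Proof.
move=> y0 y1; have [b _ Fb] := @cdf_near1 _ F (1 - y) ltac:(lra).
have [|q [qs yq _]] := @quantile _ F y 0 b y0; first lra.
have q0 : 0 < q.
  by rewrite ltNge; apply/negP => /(cdf_homo F); lra.
rewrite (equilibrium_gt0_eq q0 qs); apply: le_trans (smooth_cost_ge q).
by rewrite ler_pM2l.
Qed.

(** If nobody came at 0, arriving there would be free, forcing [c <= 0]; yet the median gives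
    [gamma / 2 <= c]. *)
Lemma equilibrium_F0_gt0 : 0 < F 0.
Proof.
rewrite lt_def cdf_ge0 andbT; apply/negP => /eqP F0.
have := @equilibrium_quantile 2^-1; rewrite F0 => /(_ ltac:(lra) ltac:(lra)).
have := equilibrium_at0_le; rewrite F0 mulr0 mul0r => c0 gc.
by have := gamma_gt0; lra.
Qed.

Lemma equilibrium_at0 : c = (a + gamma) * F 0 / 2.
Proof.
have : 0 < atom F 0 by rewrite atom0// equilibrium_F0_gt0.
move=> /support_atom/equilibrium_eq ->.
rewrite /smooth_cost weight0// atom0// mulr0 oppr0 expR0; lra.
Qed.

(** A very late arrival hardly waits. Split the weight at a time [s] with [F s > 1 - d]: after
    division by [expR (mu * t)], the part before [s] is small since [t] is large, and the part after
    [s] is at most [d]. *)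
Lemma equilibrium_le_gamma : c <= gamma.
Proof.
apply/ler_addgt0Pr => e e0; pose d := e / (2 * a).
have d0 : 0 < d by rewrite divr_gt0// mulr_gt0.
have [s s0 Fs] := cdf_near1 F d0.
(* Chosen so that [weight F mu s <= d * (mu * t) <= d * expR (mu * t)]. *)
pose t := Num.max s (weight F mu s / (mu * d)).
have t0 : 0 < t by rewrite lt_max s0.
have st : s <= t by rewrite le_max lexx.
have ws : weight F mu s <= d * (mu * t).
  have -> : d * (mu * t) = t * (mu * d) by ring.
  have : weight F mu s / (mu * d) <= t by rewrite le_max lexx orbT.
  by rewrite ler_pdivrMr// mulr_gt0.
apply: le_trans (equilibrium_gt0_le t0) _; rewrite /smooth_cost.
have /andP[_ wt] := weight_incr F mu_gt0 st.
have Ft := cdf_le1 F t.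
have E1 := expR_ge1Dx (mu * t).
have Ep := expR_gt0 (- (mu * t)).
have EE := expRxMexpNx_1 (mu * t).
have Eg := expR_gt0 (mu * t).
have : weight F mu t <= 2 * d * expR (mu * t).
  have : expR (mu * t) * (F t - F s) <= expR (mu * t) * d.
    by rewrite ler_pM2l//; lra.
  have : d * (mu * t) <= d * expR (mu * t) by rewrite ler_pM2l//; lra.
  lra.
rewrite -(ler_pM2l Ep).
have -> : expR (- (mu * t)) * (2 * d * expR (mu * t)) = 2 * d.
  by rewrite mulrCA [_ * expR (mu * t)]mulrC EE mulr1.
move=> wd.
have : a * (expR (- (mu * t)) * weight F mu t) <= a * (2 * d) by rewrite ler_pM2l.
have -> : a * (2 * d) = e by rewrite /d; field; rewrite gt_eqF.
have : gamma * F t <= gamma by rewrite ler_piMr// ltW.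
lra.
Qed.

Lemma equilibrium_eq_gamma : F 0 < 1 -> c = gamma.
Proof.
move=> F01; apply/eqP; rewrite eq_le equilibrium_le_gamma/= leNgt.
(* A level [y] in []F 0, 1[] with [gamma * y > c], against [equilibrium_quantile]. *)
apply/negP => cg; pose y := (Num.max (F 0) (c / gamma) + 1) / 2.
have cg1 : c / gamma < 1 by rewrite ltr_pdivrMr// mul1r.
have y1 : Num.max (F 0) (c / gamma) < 1 by rewrite gt_max F01.
have h1 : F 0 <= Num.max (F 0) (c / gamma) by rewrite le_max lexx.
have h2 : c / gamma <= Num.max (F 0) (c / gamma) by rewrite le_max lexx orbT.
have : gamma * y <= c by apply: equilibrium_quantile; rewrite /y; lra.
rewrite mulrC -ler_pdivlMr// /y; lra.
Qed.

(* Compare [t] with the smallest [q] such that [F q = F t], a point of the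
   support: nobody arrives in between, so the cost at [t] is at most that at [q]. *)
Lemma equilibrium_smooth_cost t : F 0 < F t -> phi t = gamma.
Proof.
move=> F0t.
have F01 : F 0 < 1 by rewrite (lt_le_trans F0t)// cdf_le1.
have pos s : F 0 < F s -> 0 < s.
  by move=> Fs; rewrite ltNge; apply/negP => /(cdf_homo F); rewrite leNgt Fs.
have cg := equilibrium_eq_gamma F01.
apply/eqP; rewrite eq_le; apply/andP; split; last first.
  by have := equilibrium_gt0_le (pos _ F0t); rewrite cg.
have [q [qs tq /(_ t (lexx _)) qt]] := quantile F0t (lexx (F t)).
have Fq : F q = F t by apply/eqP; rewrite eq_le tq cdf_homo.
have q0 : 0 < q by apply: pos; rewrite Fq.
rewrite [leRHS](_ : _ = phi q); last by rewrite -(equilibrium_gt0_eq q0 qs) cg.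
rewrite /smooth_cost Fq.
have wq : weight F mu t = weight F mu q.
  have := weight_incr F mu_gt0 qt; rewrite Fq subrr !mulr0 => /andP[? ?]; lra.
rewrite wq lerD2r ler_pM2l// ler_wpM2r ?weight_ge0//.
by rewrite ler_expR lerN2 ler_pM2l.
Qed.

End equilibrium.

Lemma weight_flat {R : realType} (F : cdf_type R) (mu t : R) :
  0 < mu -> no_early_birds F -> 0 <= t -> F t = F 0 -> weight F mu t = F 0.
Proof.
move=> mu0 F0 t0 Ft; have := weight_incr F mu0 t0.
rewrite Ft subrr !mulr0 weight0// => /andP[? ?]; lra.
Qed.

(** * Behaviour of an equilibrium before and after [te] *)

Section equilibrium_shape.
Context {R : realType} (alpha gamma mu : R).
Hypotheses (alpha_gt0 : 0 < alpha) (gamma_gt0 : 0 < gamma) (mu_gt0 : 0 < mu).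
Let a := alpha / mu.
Let a_gt0 : 0 < a. Proof. exact: divr_gt0. Qed.
Variables (F : cdf_type R) (c : R).
Hypothesis eqF : symmetric_equilibrium alpha gamma mu F c.
Local Notation phi := (smooth_cost a gamma mu F).

Let F_lt0 : no_early_birds F. Proof. by case: eqF. Qed.

Lemma equilibrium_F0 : F 0 < 1 -> F 0 = 2 * gamma / (gamma + a).
Proof.
move=> F01; have := equilibrium_at0 alpha_gt0 gamma_gt0 mu_gt0 eqF.
rewrite (equilibrium_eq_gamma alpha_gt0 gamma_gt0 mu_gt0 eqF F01) -/a => E.
have ag : gamma + a != 0 by rewrite gt_eqF// addr_gt0.
by apply: (mulIf ag); rewrite divfK//; lra.
Qed.

(** If the only mass so far is [p = 2 * gamma / (gamma + a)] at 0, the cost at [t > 0] is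
    [(a * expR (- (mu * t)) + gamma) * p]; the equation below says that it equals [gamma] at
    [te]. *)
Variable te : R.
Hypothesis te_eq : a * expR (- (mu * te)) = (a - gamma) / 2.

(** Arrivals after 0 have factor at least 1, so [F t <= weight F mu t]. If [F 0 < F t], the cost at
    [t], which is [gamma], would be at least [(a + gamma) / 2 * F t], more than the cost at 0, also
    [gamma]. *)
Lemma equilibrium_early t : F 0 < 1 -> 0 <= t -> t <= te -> F t = F 0.
Proof.
move=> F01 t0 tte; apply/eqP; rewrite eq_le [X in _ && X]cdf_homo// andbT leNgt.
apply/negP => F0t.
have := equilibrium_smooth_cost alpha_gt0 gamma_gt0 mu_gt0 eqF F0t.
have := equilibrium_at0 alpha_gt0 gamma_gt0 mu_gt0 eqF.
rewrite (equilibrium_eq_gamma alpha_gt0 gamma_gt0 mu_gt0 eqF F01) /smooth_cost -/a.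
have := weight_incr F mu_gt0 t0; rewrite weight0// mulr0 expR0 mul1r.
move=> /andP[wF _] E0 E.
have et : expR (- (mu * te)) <= expR (- (mu * t)).
  by rewrite ler_expR lerN2 ler_pM2l.
have : a * (expR (- (mu * te)) * F t) <= a * (expR (- (mu * t)) * weight F mu t).
  rewrite ler_pM2l// ler_pM ?expR_ge0 ?cdf_ge0//; lra.
rewrite mulrA te_eq => h.
have : (a + gamma) / 2 * F 0 < (a + gamma) / 2 * F t.
  by rewrite ltr_pM2l// divr_gt0// addr_gt0.
lra.
Qed.

(** If [F 0 < F t] this is [equilibrium_smooth_cost]. Otherwise [F] is flat up to [t]: at [t = te]
    the cost is computed directly, and for [t > te] it would have dropped below [gamma], which
    equilibrium forbids. *)
Lemma equilibrium_late t : F 0 < 1 -> 0 <= te -> te <= t -> phi t = gamma.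
Proof.
move=> F01 te0 tet.
have t0 : 0 <= t := le_trans te0 tet.
have E0 := equilibrium_at0 alpha_gt0 gamma_gt0 mu_gt0 eqF.
have cg := equilibrium_eq_gamma alpha_gt0 gamma_gt0 mu_gt0 eqF F01.
have p0 := equilibrium_F0_gt0 alpha_gt0 gamma_gt0 mu_gt0 eqF.
have [F0t|] := ltP (F 0) (F t).
  exact: (equilibrium_smooth_cost alpha_gt0 gamma_gt0 mu_gt0 eqF).
move=> tF; have Ft : F t = F 0 by apply/eqP; rewrite eq_le tF cdf_homo.
have [{}tet|tte] := ltP te t; last first.
  have <- : te = t by apply/eqP; rewrite eq_le tet tte.
  rewrite /smooth_cost weight_flat// ?equilibrium_early// mulrA te_eq.
  by move: E0; rewrite cg -/a; lra.
have tp : 0 < t by exact: le_lt_trans tet.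
have := equilibrium_gt0_le alpha_gt0 gamma_gt0 mu_gt0 eqF tp.
rewrite cg -/a /smooth_cost weight_flat// Ft mulrA -mulrDl => le.
have : (a * expR (- (mu * t)) + gamma) * F 0 < (a * expR (- (mu * te)) + gamma) * F 0.
  by rewrite ltr_pM2r// ltrD2r ltr_pM2l// ltr_expR ltrN2 ltr_pM2l.
move: E0; rewrite te_eq cg -/a; lra.
Qed.

End equilibrium_shape.

(* Eliminating [weight] between two times [u <= v] shows that [`|F - G|] grows
   by at most [C (v - u)] times the increment of [F + G]. *)
Lemma smooth_cost_inj {R : realType} (a gamma mu : R) (F G : cdf_type R) (s t : R) :
  0 < a -> 0 < gamma -> 0 < mu ->
  (forall u, s <= u -> smooth_cost a gamma mu F u = gamma) ->
  (forall u, s <= u -> smooth_cost a gamma mu G u = gamma) ->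
  F s = G s -> s <= t -> F t = G t.
Proof.
move=> a0 g0 mu0 HF HG FGs st; apply/eqP; rewrite -subr_eq0 -normr_le0.
pose D u := `|F u - G u|.
suff : D t <= D s by rewrite /D FGs subrr normr0.
apply: (@le_of_small_increments _ D (fun u => F u + G u) (mu * expR (mu * (t - s)))) => //.
move=> u v su uv vt; rewrite /D.
have sv := le_trans su uv.
(* Multiplying the cost equation by [expR (mu * x)] solves it for the weight. *)
have wE (H : cdf_type R) x : smooth_cost a gamma mu H x = gamma ->
    a * weight H mu x = gamma * (expR (mu * x) * (1 - H x)).
  rewrite /smooth_cost => E.
  have EE := expRxMexpNx_1 (mu * x).
  have -> : a * weight H mu x =
      expR (mu * x) * (a * (expR (- (mu * x)) * weight H mu x)).
    by rewrite [RHS]mulrCA (mulrA (expR (mu * x))) EE mul1r.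
  have -> : a * (expR (- (mu * x)) * weight H mu x) = gamma * (1 - H x) by lra.
  by rewrite mulrCA.
have := wE _ _ (HF u su); have := wE _ _ (HF v sv).
have := wE _ _ (HG u su); have := wE _ _ (HG v sv).
have := weight_incr F mu0 uv; have := weight_incr G mu0 uv.
have := expR_diff_le (mu * u) (mu * v).
have : expR (mu * v) <= expR (mu * (t - s)) * expR (mu * u).
  by rewrite -expRD ler_expR -mulrDr ler_pM2l//; lra.
have : expR (mu * u) <= expR (mu * v) by rewrite ler_expR ler_pM2l.
have := cdf_homo F uv; have := cdf_homo G uv.
have := expR_gt0 (mu * u).
set U := expR (mu * u); set V := expR (mu * v); set C := expR (mu * (t - s)).
set wFu := weight F mu u; set wFv := weight F mu v.
set wGu := weight G mu u; set wGv := weight G mu v.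
move=> U0 GG FF UV VC dE /andP[G1 G2] /andP[F1 F2] EGv EGu EFv EFu.
pose dB := F v + G v - (F u + G u).
have dB0 : 0 <= dB by rewrite /dB; lra.
(* A combination of the four weight equations; the bracket collects the errors made by replacing
   each weight increment by [U] times the increment of the cdf. *)
have main : (a * U + gamma * V) * (F v - G v) =
    (a + gamma) * U * (F u - G u) -
    a * ((wFv - wFu - U * (F v - F u)) - (wGv - wGu - U * (G v - G u))).
  by lra.
(* Each error lies between 0 and [V - U] times the increment of its cdf. *)
have th : `|(wFv - wFu - U * (F v - F u)) - (wGv - wGu - U * (G v - G u))|
    <= (V - U) * dB.
  rewrite ler_norml /dB; apply/andP; split; lra.
have ag : 0 < a + gamma by rewrite addr_gt0.
have h1 : (a + gamma) * U * `|F v - G v| <=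
    (a + gamma) * U * `|F u - G u| + a * ((V - U) * dB).
  have -> : (a + gamma) * U * `|F u - G u| = `|(a + gamma) * U * (F u - G u)|.
    by rewrite normrM gtr0_norm// mulr_gt0.
  apply: (@le_trans _ _ `|(a * U + gamma * V) * (F v - G v)|).
    rewrite normrM ger0_norm; last by rewrite addr_ge0// mulr_ge0 ?ltW//; lra.
    rewrite ler_wpM2r// mulrDl lerD2l ler_pM2l//.
  rewrite main; apply: (le_trans (ler_normB _ _)).
  by rewrite lerD2l normrM gtr0_norm// ler_pM2l.
(* The bound [V <= C * U] produces the factor [(a + gamma) * U], cancelled at the end, and leaves a
   constant independent of [u] and [v]. *)
have h2 : a * ((V - U) * dB) <= (a + gamma) * ((mu * (v - u) * (C * U)) * dB).
  apply: ler_pM => //; [exact: ltW|by apply: mulr_ge0 => //; lra|by lra|].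
  rewrite ler_wpM2r//; apply: (le_trans dE).
  rewrite -mulrBr; apply: ler_wpM2l => //.
  by rewrite mulr_ge0 ?subr_ge0 ?(ltW mu0).
rewrite -(ler_pM2l (mulr_gt0 ag U0)) -/dB; lra.
Qed.

(** * The candidate distribution and its density *)

Lemma ex_cdf {R : realType} (f : R -> R) :
  nondecreasing f -> right_continuous f ->
  f @ -oo --> (0 : R) -> f @ +oo --> (1 : R) ->
  exists F : cdf_type R, F =1 f.
Proof.
move=> ndf rcf fN fP.
have cf := isCumulative.Build R _ R f ndf rcf.
have bf := isCumulativeBounded.Build R 0 1 f fN fP.
pose F : cdf_type R := HB.pack f cf bf.
by exists F.
Qed.

(* An atom [p] at [0], and mass [1 - p] spread as [T + Exp(k)]. *)
Definition delayed_exponential {R : realType} (p k T t : R) : R :=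
  if t < 0 then 0 else 1 - (1 - p) * expR (- (k * Num.max 0 (t - T))).

Section delayed_exponential.
Context {R : realType} (p k T : R).
Hypotheses (p_ge0 : 0 <= p) (p_le1 : p <= 1) (k_gt0 : 0 < k) (T_ge0 : 0 <= T).
Local Notation G := (delayed_exponential p k T).

Lemma delayed_exponential_lt0 t : t < 0 -> G t = 0.
Proof. by rewrite /delayed_exponential => ->. Qed.

Lemma delayed_exponential_early t : 0 <= t -> t <= T -> G t = p.
Proof.
move=> t0 tT; rewrite /delayed_exponential ltNge t0/= max_l ?subr_le0//.
by rewrite mulr0 oppr0 expR0 mulr1 subKr.
Qed.

Lemma delayed_exponential_late t : T <= t ->
  G t = 1 - (1 - p) * expR (- (k * (t - T))).
Proof.
move=> tT; rewrite /delayed_exponential ltNge (le_trans T_ge0 tT)/=.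
by rewrite max_r ?subr_ge0.
Qed.

Lemma delayed_exponential_ge0 t : 0 <= G t.
Proof.
rewrite /delayed_exponential; case: ifP => // _.
have : expR (- (k * Num.max 0 (t - T))) <= 1.
  by rewrite expR_le1 oppr_le0 mulr_ge0 ?(ltW k_gt0)// le_max lexx.
by move=> e1; rewrite subr_ge0 mulr_ile1 ?expR_ge0 ?subr_ge0 ?gerBl.
Qed.

Lemma delayed_exponential_le s t : s <= t -> G s <= G t.
Proof.
move=> st; have [s0|s0] := ltP s 0.
  by rewrite delayed_exponential_lt0// delayed_exponential_ge0.
rewrite /delayed_exponential !ltNge s0 (le_trans s0 st)/=.
rewrite lerD2l lerN2 ler_wpM2l ?subr_ge0// ler_expR lerN2 ler_pM2l//.
by rewrite ge_max !le_max lexx/= lerD2r st orbT.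
Qed.

(** [Num.max 0] is 1-Lipschitz and [expR (- (k * u))] is [k]-Lipschitz on [u >= 0]; [0 <= s] keeps
    the jump at 0 out. This yields right continuity and the absence of atoms after 0. *)
Lemma delayed_exponential_lipschitz s t : 0 <= s -> s <= t ->
  G t - G s <= k * (t - s).
Proof.
move=> s0 st; rewrite /delayed_exponential !ltNge s0 (le_trans s0 st)/=.
set u := Num.max 0 (s - T); set v := Num.max 0 (t - T).
have uv : u <= v by rewrite /u /v ge_max !le_max lexx/= lerD2r st orbT.
have vu : v - u <= t - s.
  by rewrite /u /v; case: (leP 0 (t - T)); case: (leP 0 (s - T)) => h1 h2; lra.
have u0 : 0 <= u by rewrite /u le_max lexx.
have e1 : expR (- (k * u)) <= 1 by rewrite expR_le1 oppr_le0 mulr_ge0// ltW.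
have := expR_diff_le (- (k * v)) (- (k * u)).
have : k * (v - u) <= k * (t - s) by rewrite ler_pM2l.
have : expR (- (k * v)) <= expR (- (k * u)).
  by rewrite ler_expR lerN2 ler_pM2l.
have : 0 <= k * (v - u) by rewrite mulr_ge0 ?subr_ge0// ltW.
have := expR_ge0 (- (k * u)).
set eu := expR (- (k * u)) in e1 *; set ev := expR _.
move=> eu0 kvu evu kk d.
have d1 : eu - ev <= k * (v - u).
  have : k * (v - u) * eu <= k * (v - u) by rewrite ler_piMr.
  lra.
have : (1 - p) * (eu - ev) <= eu - ev.
  by rewrite ler_piMl ?gerBl// subr_ge0.
lra.
Qed.

Lemma delayed_exponential_rc : right_continuous G.
Proof.
move=> x; have [x0|x0] := ltP x 0.
  rewrite delayed_exponential_lt0//; apply: cvg_near_cst; near=> y.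
  by apply: delayed_exponential_lt0; near: y; exact: nbhs_right_lt.
apply/cvgrPdist_le => e e0; near=> y.
have xy : x <= y by near: y; exact: nbhs_right_ge.
rewrite distrC ger0_norm ?subr_ge0 ?delayed_exponential_le//.
apply: (le_trans (delayed_exponential_lipschitz x0 xy)).
rewrite mulrC -ler_pdivlMr// lerBlDl; near: y.
by apply: nbhs_right_le; rewrite ltrDl divr_gt0.
Unshelve. all: by end_near. Qed.

Lemma delayed_exponential_Ny : G @ -oo --> (0 : R).
Proof.
apply: cvg_near_cst; near=> y.
by apply: delayed_exponential_lt0; near: y; exact: nbhs_ninfty_lt.
Unshelve. all: by end_near. Qed.

Lemma delayed_exponential_y : G @ +oo --> (1 : R).
Proof.
apply/cvgrPdist_le => e e0; near=> y.
have yT : T < y by near: y; apply: nbhs_pinfty_gt; rewrite num_real.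
rewrite delayed_exponential_late ?(ltW yT)// subKr.
rewrite ger0_norm ?mulr_ge0 ?expR_ge0 ?subr_ge0//.
have ky : 0 < k * (y - T) by rewrite mulr_gt0// subr_gt0.
apply: (@le_trans _ _ (expR (- (k * (y - T))))).
  by rewrite ler_piMl ?expR_ge0// gerBl.
rewrite expRN -[leRHS]invrK lef_pV2 ?posrE ?invr_gt0 ?expR_gt0//.
apply: (@le_trans _ _ (k * (y - T))); last first.
  by have := expR_ge1Dx (k * (y - T)); lra.
rewrite mulrC -ler_pdivrMr// lerBrDr; near: y.
by apply: nbhs_pinfty_ge; rewrite num_real.
Unshelve. all: by end_near. Qed.

Lemma delayed_exponential_cdf : exists F : cdf_type R, F =1 G.
Proof.
apply: ex_cdf; [exact: delayed_exponential_le|exact: delayed_exponential_rc|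
  exact: delayed_exponential_Ny|exact: delayed_exponential_y].
Qed.

End delayed_exponential.

(** The measure with density [h] plus mass [p] at 0 agrees with the Stieltjes measure on every []s,
    t]], the boolean telling whether 0 lies in it. By uniqueness the two coincide, and the mass at 0
    is invisible inside []0, +oo[]. *)
Lemma stieltjes_density {R : realType} (F : cdf_type R) (p : R) (h : R -> R) :
  0 <= p -> measurable_fun setT h -> (forall x, 0 <= h x) ->
  (forall s t, s <= t -> (\int[@lebesgue_measure R]_(x in `]s, t]) (h x)%:E +
    (p * ((s < 0) && (0 <= t))%:R)%:E = (F t - F s)%:E)%E) ->
  has_density_on F `]0, +oo[ h.
Proof.
move=> p0 mh h0 H A mA A0.
pose nu0 (B : set (measurableTypeR R)) :=
  (\int[@lebesgue_measure R]_(x in B) (h x)%:E)%E.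
have nu00 : nu0 set0 = 0%E by rewrite /nu0 integral_set0.
have nu0_ge0 B : (0 <= nu0 B)%E.
  by apply: integral_ge0 => x _; rewrite lee_fin.
have nu0_sigma : semi_sigma_additive nu0.
  apply: semi_sigma_additive_nng_induced; first exact/measurable_EFinP.
  by move=> x; rewrite lee_fin.
pose nu1 : {measure set (measurableTypeR R) -> \bar R} :=
  HB.pack nu0 (isMeasure.Build _ _ _ nu0 nu00 nu0_ge0 nu0_sigma).
pose atom0 : {measure set (measurableTypeR R) -> \bar R} :=
  mscale (NngNum p0) (@dirac _ (measurableTypeR R) 0 R).
pose nu : {measure set (measurableTypeR R) -> \bar R} := measure_add nu1 atom0.
have nuE B : nu B = (nu0 B + p%:E * (0 \in B)%:R%:E)%E.
  by rewrite [LHS]measure_addE /= /mscale/= diracE.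
rewrite (@lebesgue_stieltjes_measure_unique _ F nu)//.
  rewrite nuE memNset ?mule0 ?adde0//.
  by move=> /A0 /=; rewrite in_itv/= ltxx.
move=> _ [[s t] _ <-] /=; rewrite nuE.
have [st|ts] := leP s t; last first.
  rewrite set_itv_ge ?bnd_simp -?leNgt ?(ltW ts)// measure0 nu00.
  by rewrite memNset// mule0 adde0.
by rewrite stieltjes_itvoc// -H// mem_setE in_itv/= EFinM.
Qed.

Section delayed_exponential_density.
Context {R : realType} (p k T : R).
Hypotheses (p_ge0 : 0 <= p) (p_le1 : p <= 1) (k_gt0 : 0 < k) (T_ge0 : 0 <= T).

Let f (t : R) := (1 - p) * k * expR (- (k * (t - T))).
Let g (t : R) := - ((1 - p) * expR (- (k * (t - T)))).

Let dg (x : R) : is_derive x 1 g (f x).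
Proof.
rewrite /g /f.
have d1 : is_derive x 1 (fun t : R => - (k * (t - T))) (- k).
  rewrite (_ : (fun t : R => _) = - (k \*: (id - cst T))); last by [].
  by apply: is_derive_eq; rewrite subr0 scaler1.
have d2 : is_derive x 1 (expR \o (fun t : R => - (k * (t - T))))
    (expR (- (k * (x - T))) * - k) by exact: is_derive1_comp.
rewrite (_ : (fun t : R => _) =
    - ((1 - p) \*: (expR \o (fun t : R => - (k * (t - T)))))); last by [].
by apply: is_derive_eq; rewrite /GRing.scale/=; ring.
Qed.

Let cf : continuous f.
Proof.
move=> x; rewrite /f; apply: cvgM; first exact: cvg_cst.
apply: (@continuous_comp _ _ _ (fun t => - (k * (t - T))) expR).
  by apply: cvgN; apply: cvgM; [exact: cvg_cst|apply: cvgB; [|exact: cvg_cst]].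
exact: continuous_expR.
Qed.

Let cg : continuous g.
Proof.
move=> x; apply/differentiable_continuous/derivable1_diffP.
by have [] := dg x.
Qed.

Let integral_f u v : u <= v ->
  (\int[@lebesgue_measure R]_(x in `[u, v]) (f x)%:E = (g v - g u)%:E)%E.
Proof.
rewrite le_eqVlt => /predU1P[<-|uv]; first by rewrite set_itv1 integral_set1 subrr.
rewrite EFinB (@continuous_FTC2 _ f g)//.
- exact: continuous_subspaceT.
- split; first by move=> x _; have [] := dg x.
  + by apply: cvg_at_right_filter; exact: cg.
  + by apply: cvg_at_left_filter; exact: cg.
- by move=> x _; rewrite derive1E; have [_ ->] := dg x.
Qed.

Let h (t : R) := f t * (T <= t)%R%:R.

Let mh : measurable_fun setT h.
Proof.
apply: measurable_funM; first exact: continuous_measurable_fun.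
rewrite (_ : (fun t => _) = \1_(`[T, +oo[%classic : set R)).
  exact: measurable_indic.
by apply/funext => t; rewrite indicE mem_setE in_itv/= andbT.
Qed.

(** As [h] vanishes before [T], both endpoints can be pushed up to [T]; [g] is a primitive of
    [f]. *)
Let integral_h s t : s <= t ->
  (\int[@lebesgue_measure R]_(x in `]s, t]) (h x)%:E =
   (g (Num.max t T) - g (Num.max s T))%:E)%E.
Proof.
move=> st; transitivity
    (\int[@lebesgue_measure R]_(x in `]s, t] `&` `[T, +oo[) (f x)%:E)%E.
  rewrite integral_mkcondr; apply: eq_integral => x _.
  rewrite patchE mem_setE in_itv/= andbT /h; case: ifP => _; last by rewrite mulr0.
  by rewrite mulr1.
have mf D : measurable_fun D (EFin \o f).
  apply/measurable_funTS/measurable_EFinP.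
  exact: continuous_measurable_fun.
have [Ts|sT] := leP T s.
  rewrite (_ : _ `&` _ = `]s, t]%classic).
    rewrite integral_itv_obnd_cbnd; last exact: mf.
    by rewrite integral_f// max_l// (le_trans Ts).
  apply/setIidPl => x /=; rewrite !in_itv/= andbT => /andP[sx _].
  by rewrite (le_trans Ts)// ltW.
have [Tt|tT] := leP T t.
  rewrite (_ : _ `&` _ = `[T, t]%classic); first by rewrite integral_f.
  apply/seteqP; split => x /=; rewrite !in_itv/= andbT.
    by move=> [/andP[_ ->] ->].
  by move=> /andP[Tx ->]; rewrite Tx (lt_le_trans sT).
rewrite (_ : _ `&` _ = set0) ?integral_set0 ?subrr//.
apply/seteqP; split => x //=; rewrite !in_itv/= andbT => -[/andP[_ xt] Tx].
by have := le_lt_trans (le_trans Tx xt) tT; rewrite ltxx.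
Qed.

Lemma delayed_exponential_density (F : cdf_type R) :
  F =1 delayed_exponential p k T -> has_density_on F `]0, +oo[ h.
Proof.
move=> FG; apply: (@stieltjes_density _ F p) => //.
  move=> x; rewrite /h mulr_ge0// /f mulr_ge0 ?expR_ge0//.
  by rewrite mulr_ge0 ?subr_ge0// ltW.
move=> s t st; rewrite integral_h// -EFinD; congr EFin; rewrite !FG.
have GE u : 0 <= u -> delayed_exponential p k T u = 1 + g (Num.max u T).
  move=> u0; rewrite /delayed_exponential ltNge u0/= /g.
  congr (1 - _ * expR (- (k * _))).
  have [uT|Tu] := leP u T; first by rewrite max_l ?subr_le0// subrr.
  by rewrite max_r// subr_ge0 ltW.
have [s0|s0] := ltP s 0; have [t0|t0] := leP 0 t => /=.
- rewrite (delayed_exponential_lt0 _ _ _ s0) GE// [Num.max s T]max_r ?(le_trans (ltW s0))//.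
  by rewrite {2}/g subrr mulr0 oppr0 expR0; lra.
- rewrite !delayed_exponential_lt0// !max_r ?(le_trans (ltW _) T_ge0)//.
  by rewrite !subrr mulr0 addr0.
- by rewrite !GE//; lra.
- by have := lt_le_trans t0 (le_trans s0 st); rewrite ltxx.
Qed.

End delayed_exponential_density.

(** Over []u, v]] the increments of [weight F mu] and [Z] lie in the same interval, of length [(expR
    (mu * v) - expR (mu * u)) * (F v - F u)], which is of second order. A closed form of the weight
    can thus be checked without evaluating the integral. *)
Lemma weight_unique {R : realType} (F : cdf_type R) (Z : R -> R) (mu s t : R) :
  0 < mu ->
  (forall u v, s <= u -> u <= v ->
    expR (mu * u) * (F v - F u) <= Z v - Z u <= expR (mu * v) * (F v - F u)) ->
  weight F mu s = Z s -> s <= t -> weight F mu t = Z t.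
Proof.
move=> mu0 HZ Zs st; apply/eqP; rewrite -subr_eq0 -normr_le0.
suff : `|weight F mu t - Z t| <= `|weight F mu s - Z s|.
  by rewrite Zs subrr normr0.
apply: (@le_of_small_increments _ (fun u => `|weight F mu u - Z u|) F
  (mu * expR (mu * t))) => //.
move=> u v su uv vt; have /andP[z1 z2] := HZ u v su uv.
have /andP[w1 w2] := weight_incr F mu0 uv.
apply: le_trans (lerB_dist _ _) _.
have E := expR_diff_le (mu * u) (mu * v).
have Evt : expR (mu * v) <= expR (mu * t) by rewrite ler_expR ler_pM2l.
have dF : 0 <= F v - F u by rewrite subr_ge0 cdf_homo.
have bound : (expR (mu * v) - expR (mu * u)) * (F v - F u) <=
    mu * expR (mu * t) * (v - u) * (F v - F u).
  rewrite ler_wpM2r//; apply: (le_trans E); rewrite -mulrBr.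
  by rewrite mulrAC ler_wpM2r ?subr_ge0// ler_pM2l.
apply: le_trans bound; rewrite ler_norml; apply/andP; split; lra.
Qed.

(** * Atoms and support of the candidate distribution *)

Section delayed_exponential_equilibrium.
Context {R : realType} (p k T : R) (F : cdf_type R).
Hypotheses (p_gt0 : 0 < p) (p_le1 : p <= 1) (k_gt0 : 0 < k) (T_ge0 : 0 <= T).
Hypothesis FG : F =1 delayed_exponential p k T.

Lemma delayed_no_early_birds : no_early_birds F.
Proof. by move=> t t0; rewrite FG delayed_exponential_lt0. Qed.

Lemma delayed_early t : 0 <= t -> t <= T -> F t = p.
Proof. by move=> t0 tT; rewrite FG delayed_exponential_early. Qed.

Lemma delayed_atom t : 0 < t -> atom F t = 0.
Proof.
move=> t0; apply/eqP; rewrite eq_le atom_ge0 andbT.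
apply: (@le0_of_le_small _ _ k t t0) => d d0 dt.
have st : t - d < t by rewrite gtrBl.
apply: (le_trans (atom_le F st)); rewrite !FG.
rewrite -{2}(subKr t d); apply: delayed_exponential_lipschitz.
all: by rewrite ?subr_ge0// ltW.
Qed.

Lemma delayed_support0 : cdf_support F 0.
Proof.
apply: support_atom; rewrite atom0; last exact: delayed_no_early_birds.
by rewrite delayed_early.
Qed.

Lemma delayed_supportN t : t < 0 -> ~ cdf_support F t.
Proof.
move=> t0; apply: (@support_flat _ _ (t - 1) t (t / 2)); [lra|lra|].
by rewrite !delayed_no_early_birds//; lra.
Qed.

Lemma delayed_support : p < 1 ->
  cdf_support F = [set 0] `|` `[T, +oo[.
Proof.
move=> p1; apply/seteqP; split => t /=; rewrite in_itv/= andbT.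
  move=> Ft; have [t0|t0|->] := ltgtP t 0; [|right|by left].
    by case: (delayed_supportN t0).
  rewrite leNgt; apply/negP => tT; move: Ft.
  apply: (@support_flat _ _ (t / 2) t T) => //; first lra.
  by rewrite !delayed_early//; lra.
case=> [->|Tt]; first exact: delayed_support0.
apply: support_right => s ts; rewrite !FG !delayed_exponential_late//; last first.
  exact: le_trans (ltW ts).
by rewrite ltrD2l ltrN2 ltr_pM2l ?subr_gt0// ltr_expR ltrN2 ltr_pM2l// ltrD2r.
Qed.

End delayed_exponential_equilibrium.

(** Each piece is clipped to the window by [Num.max] and [Num.min]; a piece that misses the window
    gets endpoints in the wrong order, hence an empty interval. *)
Lemma locally_finite_point_ray {R : realType} (T : R) :
  locally_finite_union_of_intervals ([set 0] `|` `[T, +oo[).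
Proof.
move=> x y; exists [:: (Num.max x 0, Num.min y 0); (Num.max x T, y)].
apply/seteqP; split => t /=.
  rewrite !in_itv/= andbT => -[+ /andP[xt ty]] => -[t0|Tt].
    exists (Num.max x 0, Num.min y 0); first by rewrite /= mem_head.
    by rewrite /= in_itv/= ge_max le_min xt ty t0 lexx.
  exists (Num.max x T, y); first by rewrite /= !inE eqxx orbT.
  by rewrite /= in_itv/= ge_max xt Tt.
move=> [q /=]; rewrite in_cons mem_seq1 => /orP[|] /eqP -> /=; rewrite !in_itv/= andbT.
  rewrite ge_max le_min => /andP[/andP[xt t0] /andP[ty t0']].
  by split; [left; apply/eqP; rewrite eq_le t0' t0|rewrite xt ty].
by rewrite ge_max => /andP[/andP[xt Tt] ty]; split; [right|rewrite xt ty].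
Qed.

Lemma locally_finite_point {R : realType} :
  locally_finite_union_of_intervals ([set 0] : set R).
Proof.
move=> x y; exists [:: (Num.max x 0, Num.min y 0)].
apply/seteqP; split => t /=.
  rewrite !in_itv/= => -[t0 /andP[xt ty]].
  exists (Num.max x 0, Num.min y 0); first by rewrite /= mem_head.
  by rewrite /= in_itv/= ge_max le_min xt ty t0 lexx.
move=> [q /=]; rewrite mem_seq1 => /eqP -> /=; rewrite !in_itv/=.
rewrite ge_max le_min => /andP[/andP[xt t0] /andP[ty t0']].
by split; [apply/eqP; rewrite eq_le t0' t0|rewrite xt ty].
Qed.

(** * The explicit candidates are equilibria *)

Section explicit_equilibria.
Context {R : realType} (alpha gamma mu : R).
Hypotheses (alpha_gt0 : 0 < alpha) (gamma_gt0 : 0 < gamma) (mu_gt0 : 0 < mu).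
Let a := alpha / mu.
Let a_gt0 : 0 < a. Proof. exact: divr_gt0. Qed.

Lemma cost_at0 (F : cdf_type R) : no_early_birds F ->
  cost alpha gamma mu F 0 = ((a + gamma) * F 0 / 2)%:E.
Proof.
move=> F0; rewrite costE// weight0// atom0// mulr0 oppr0 expR0 -/a.
by congr EFin; lra.
Qed.

(** Whoever comes after 0 is surely second and pays at least [gamma], which is no less than the
    average of [a] and [gamma]. *)
Lemma immediate_equilibrium (F : cdf_type R) : a <= gamma ->
  F =1 delayed_exponential 1 1 0 ->
  symmetric_equilibrium alpha gamma mu F (2^-1 * (a + gamma)).
Proof.
move=> ag FG.
have F1 t : 0 <= t -> F t = 1.
  by move=> t0; rewrite FG delayed_exponential_late// subrr mul0r subr0.
have F0 : no_early_birds F by exact: delayed_no_early_birds FG.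
have cost0 : cost alpha gamma mu F 0 = (2^-1 * (a + gamma))%:E.
  by rewrite cost_at0// F1// mulr1 mulrC.
have suppF : cdf_support F = [set 0].
  apply/seteqP; split => t /=; last first.
    by move=> ->; apply: delayed_support0 FG.
  move=> Ft; have [t0|t0|//] := ltgtP t 0.
    by case: (delayed_supportN FG t0 Ft).
  exfalso; apply: (@support_flat _ F (t / 2) t (t + 1)) Ft; [lra|lra|].
  by rewrite !F1//; lra.
split; first exact: F0.
- by rewrite suppF; exact: locally_finite_point.
- by rewrite suppF => t ->.
move=> t; rewrite le_eqVlt => /predU1P[<-|t0]; first by rewrite cost0.
rewrite costE// (delayed_atom _ _ FG)// mulr0 mul0r subr0 -/a lee_fin.
rewrite F1 ?(ltW t0)// mulr1.
have : 0 <= a * (expR (- (mu * t)) * weight F mu t).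
  by rewrite mulr_ge0 ?(ltW a_gt0)// mulr_ge0 ?expR_ge0 ?weight_ge0.
lra.
Qed.

Variables (p k te : R) (F : cdf_type R).
Hypotheses (p_def : p = 2 * gamma / (gamma + a)) (k_def : k = mu / 2 * p).
Hypotheses (te_ge0 : 0 <= te) (te_eq : a * expR (- (mu * te)) = (a - gamma) / 2).
Hypotheses (ga : gamma < a) (FG : F =1 delayed_exponential p k te).

Let ag0 : 0 < gamma + a. Proof. exact: addr_gt0. Qed.
Let p_gt0 : 0 < p. Proof. by rewrite p_def divr_gt0// mulr_gt0. Qed.
Let p_lt1 : p < 1.
Proof. by rewrite p_def ltr_pdivrMr//; have := ga; lra. Qed.
Let pE : p * (gamma + a) = 2 * gamma.
Proof. by rewrite p_def divfK// gt_eqF. Qed.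
Let k_gt0 : 0 < k. Proof. by rewrite k_def mulr_gt0// divr_gt0. Qed.
(** This is the derivative of [a * weight F mu t = gamma * (expR (mu * t) * (1 - F t))] when [1 - F]
    decays at rate [k]; it singles out the rate. *)
Let kE : a * k = gamma * (mu - k).
Proof.
have -> : gamma * (mu - k) = mu * (p * (gamma + a)) / 2 - gamma * k.
  by rewrite pE; field.
by rewrite k_def; field.
Qed.

(** [weight_unique] applies to the closed form [Z]: the values at [te] agree by [te_eq], and the
    increments are compared through tangents. *)
Lemma delayed_weight t : te <= t ->
  a * weight F mu t = gamma * (expR (mu * t) * (1 - F t)).
Proof.
move=> tet.
have F0 : no_early_birds F by exact: delayed_no_early_birds FG.
have FE u : te <= u -> 1 - F u = (1 - p) * (expR (k * te) * expR (- (k * u))).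
  move=> teu; rewrite FG delayed_exponential_late// subKr -expRD.
  by congr (_ * expR _); ring.
(* The required value of the weight, rewritten as a single exponential in [u]. *)
pose Z u := gamma / a * (1 - p) * (expR (k * te) * expR ((mu - k) * u)).
have ZE u : te <= u -> Z u = gamma / a * (expR (mu * u) * (1 - F u)).
  move=> teu; rewrite FE// /Z.
  have -> : expR ((mu - k) * u) = expR (mu * u) * expR (- (k * u)).
    by rewrite -expRD; congr expR; ring.
  by ring.
suff -> : weight F mu t = Z t.
  by rewrite ZE// mulrA (mulrC a) divfK// gt_eqF.
apply: (@weight_unique _ F Z mu te) => //; last first.
  rewrite weight_flat// ?ZE// !(delayed_early FG)//.
  apply: (mulfI (lt0r_neq0 a_gt0)); rewrite [RHS]mulrA [in RHS](mulrC a) divfK ?gt_eqF//.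
  have EE := expRxMexpNx_1 (mu * te).
  have : a * p * expR (- (mu * te)) = gamma * (1 - p).
    by rewrite mulrAC te_eq; have := pE; lra.
  move=> /(congr1 (fun x => expR (mu * te) * x)).
  by rewrite mulrCA EE mulr1 => ->; ring.
move=> u v su uv.
have sv := le_trans su uv.
pose C := (1 - p) * expR (k * te).
have C0 : 0 <= C by rewrite mulr_ge0 ?expR_ge0// subr_ge0 ltW.
have dF : F v - F u = C * (expR (- (k * u)) - expR (- (k * v))).
  have := FE u su; have := FE v sv; rewrite /C; lra.
have dZ : Z v - Z u = C * (gamma / a * (expR ((mu - k) * v) - expR ((mu - k) * u))).
  by rewrite /Z /C; ring.
have split x : expR ((mu - k) * x) = expR (mu * x) * expR (- (k * x)).
  by rewrite -expRD; congr expR; ring.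
have r0 : 0 < gamma / a by rewrite divr_gt0.
have rk : gamma / a * (mu - k) = k.
  by rewrite mulrAC -kE mulrC mulKf// gt_eqF.
(* The slope of [Z] at [x] is [expR (mu * x)] times that of [F]. With [Z] convex and [F] concave
   past [te], this common tangent separates the two increments: at [x = u] for the lower bound, at
   [x = v] for the upper one. *)
have slope x : gamma / a * ((mu - k) * (v - u) * expR ((mu - k) * x)) =
    expR (mu * x) * (k * (v - u) * expR (- (k * x))).
  transitivity (gamma / a * (mu - k) * ((v - u) * expR ((mu - k) * x))); first by ring.
  by rewrite rk split; ring.
rewrite dF dZ ![expR (mu * _) * (C * _)]mulrCA.
have Eu := expR_gt0 (mu * u); have Ev := expR_gt0 (mu * v).
apply/andP; split; apply: ler_wpM2l => //.
  apply: (@le_trans _ _ (gamma / a * ((mu - k) * (v - u) * expR ((mu - k) * u)))).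
    rewrite slope.
    rewrite ler_pM2l//; have := expR_diff_le (- (k * v)) (- (k * u)); lra.
  rewrite ler_pM2l//.
  have := expR_diff_le ((mu - k) * v) ((mu - k) * u); lra.
apply: (@le_trans _ _ (gamma / a * ((mu - k) * (v - u) * expR ((mu - k) * v)))).
  rewrite ler_pM2l//.
  have := expR_diff_le ((mu - k) * u) ((mu - k) * v); lra.
rewrite slope.
rewrite ler_pM2l//; have := expR_diff_le (- (k * u)) (- (k * v)); lra.
Qed.

Lemma delayed_smooth_cost t : te <= t -> smooth_cost a gamma mu F t = gamma.
Proof.
move=> tet; rewrite /smooth_cost mulrCA delayed_weight//.
have EE := expRxMexpNx_1 (mu * t).
have -> : expR (- (mu * t)) * (gamma * (expR (mu * t) * (1 - F t))) =
    (expR (mu * t) * expR (- (mu * t))) * (gamma * (1 - F t)) by ring.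
by rewrite EE; ring.
Qed.

Lemma delayed_equilibrium : symmetric_equilibrium alpha gamma mu F gamma.
Proof.
have F0 : no_early_birds F by exact: delayed_no_early_birds FG.
have Fe t : 0 <= t -> t <= te -> F t = p.
  by move=> t0 tte; apply: (delayed_early FG).
have cost0 : cost alpha gamma mu F 0 = gamma%:E.
  by rewrite cost_at0// Fe//; congr EFin; have := pE; lra.
have costp t : 0 < t -> cost alpha gamma mu F t = (smooth_cost a gamma mu F t)%:E.
  move=> t0; rewrite costE// (delayed_atom _ _ FG) ?ltW//.
  by rewrite mulr0 mul0r subr0.
have late t : te <= t -> 0 < t -> cost alpha gamma mu F t = gamma%:E.
  by move=> tet t0; rewrite costp// delayed_smooth_cost.
have suppF : cdf_support F = [set 0] `|` `[te, +oo[.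
  exact: (@delayed_support R p k te F).
split; first exact: F0.
- by rewrite suppF; exact: locally_finite_point_ray.
- rewrite suppF => t /= [->//|]; rewrite in_itv/= andbT => tet.
  have := le_trans te_ge0 tet; rewrite le_eqVlt => /predU1P[<-//|t0].
  exact: late.
move=> t; rewrite le_eqVlt => /predU1P[<-|t0]; first by rewrite cost0.
have [tet|tte] := leP te t; first by rewrite late.
(* Writing [gamma] as the cost at [te] leaves a comparison of survival factors, since nobody arrives
   between [t] and [te]. *)
rewrite costp// lee_fin -[leLHS](delayed_smooth_cost (lexx te)) /smooth_cost.
rewrite !weight_flat ?(ltW t0)// ?Fe// ?(ltW t0)// ?(ltW tte)//.
rewrite lerD2r ler_pM2l// ler_pM2r// ler_expR lerN2 ler_pM2l//.
exact: ltW.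
Qed.

End explicit_equilibria.

(** * Existence and uniqueness in the two regimes *)

Theorem theorem2p2 (R : realType) (alpha gamma mu : R)
    (alpha_gt0 : 0 < alpha) (gamma_gt0 : 0 < gamma) (mu_gt0 : 0 < mu) :
  (alpha / mu <= gamma ->
    exists F : cdf_type R,
      F 0 = 1 /\
      the_symmetric_equilibrium alpha gamma mu F
        (2^-1 * (alpha / mu + gamma))) /\
  (gamma < alpha / mu ->
    let p0 : R := 2 * gamma / (gamma + alpha / mu) in
    let te : R := - mu^-1 * ln (2^-1 * (1 - gamma * mu / alpha)) in
    exists F : cdf_type R,
      [/\ F 0 = p0,
          has_density_on F `]0, +oo[ (fun t =>
            (1 - p0) * (mu / 2) * p0 * expR (- (mu / 2 * p0 * (t - te)))
            * (te <= t)%R%:R) &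
          the_symmetric_equilibrium alpha gamma mu F gamma]).
Proof.
have a_gt0 : 0 < alpha / mu by exact: divr_gt0.
split=> [ag|ga p0 te].
  (* With [p = 1] the exponential part has mass zero: this is the unit mass at 0. *)
  have [F FG] := @delayed_exponential_cdf R 1 1 0 ler01 (lexx 1) ltr01 (lexx 0).
  have F0 : F 0 = 1 by rewrite FG delayed_exponential_early.
  have eqF := immediate_equilibrium alpha_gt0 mu_gt0 ag FG.
  exists F; split=> //; split=> // G c' eqG.
  (* Otherwise [G 0 = 2 * gamma / (gamma + alpha / mu)], which is at least 1 in this regime. *)
  have G0 : G 0 = 1.
    apply/eqP; rewrite eq_le cdf_le1 leNgt; apply/negP => G01.
    move: (G01); rewrite (equilibrium_F0 alpha_gt0 gamma_gt0 mu_gt0 eqG G01).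
    rewrite ltr_pdivrMr ?addr_gt0//; lra.
  split; last first.
    by rewrite (equilibrium_at0 alpha_gt0 gamma_gt0 mu_gt0 eqG) G0; lra.
  have [G_lt0 _ _ _] := eqG; have [F_lt0 _ _ _] := eqF.
  move=> t; have [t0|t0] := ltP t 0; first by rewrite G_lt0// F_lt0.
  have G1 (H : cdf_type R) : H 0 = 1 -> H t = 1.
    by move=> H0; apply/eqP; rewrite eq_le cdf_le1 -{1}H0 cdf_homo.
  by rewrite !G1.
pose a := alpha / mu.
have ag0 : 0 < gamma + a by rewrite addr_gt0.
have p0_gt0 : 0 < p0 by rewrite divr_gt0// mulr_gt0.
have p0_lt1 : p0 < 1 by rewrite ltr_pdivrMr// mul1r; move: ga; rewrite -/a; lra.
have te_eq : a * expR (- (mu * te)) = (a - gamma) / 2.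
  rewrite /te mulNr mulrN opprK mulVKf ?gt_eqF// lnK.
    by rewrite /a; field; rewrite !gt_eqF.
  (* The argument of [ln] is positive exactly because [gamma < alpha / mu]. *)
  rewrite posrE mulr_gt0// subr_gt0 ltr_pdivrMr// mul1r.
  by rewrite -ltr_pdivlMr.
have te_ge0 : 0 <= te.
  have : expR (- (mu * te)) <= 1.
    by rewrite -(ler_pM2l a_gt0) -/a te_eq; lra.
  by rewrite expR_le1 oppr_le0 pmulr_rge0.
pose k := mu / 2 * p0.
have k_gt0 : 0 < k by rewrite mulr_gt0// divr_gt0.
have [F FG] := delayed_exponential_cdf (ltW p0_gt0) (ltW p0_lt1) k_gt0 te_ge0.
have F0 : F 0 = p0 by rewrite FG delayed_exponential_early.
have eqF : symmetric_equilibrium alpha gamma mu F gamma.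
  exact: (@delayed_equilibrium _ _ _ _ _ _ _ p0 k te).
exists F; split=> //.
  have := delayed_exponential_density (ltW p0_gt0) (ltW p0_lt1) k_gt0 te_ge0 FG.
  congr has_density_on; apply/funext => t.
  by rewrite /k mulrA.
split=> // G c' eqG.
(* If [G 0 = 1], the cost would be [(a + gamma) / 2 > gamma], against [equilibrium_le_gamma]. *)
have G01 : G 0 < 1.
  rewrite lt_neqAle cdf_le1 andbT; apply/eqP => G0.
  have := equilibrium_le_gamma alpha_gt0 gamma_gt0 mu_gt0 eqG.
  by rewrite (equilibrium_at0 alpha_gt0 gamma_gt0 mu_gt0 eqG) G0; lra.
have F01 : F 0 < 1 by rewrite F0.
have G0 : G 0 = F 0.
  by rewrite F0 (equilibrium_F0 alpha_gt0 gamma_gt0 mu_gt0 eqG).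
split; last exact: (equilibrium_eq_gamma alpha_gt0 gamma_gt0 mu_gt0 eqG).
have [G_lt0 _ _ _] := eqG; have [F_lt0 _ _ _] := eqF.
move=> t; have [t0|t0] := ltP t 0; first by rewrite G_lt0// F_lt0.
have early := equilibrium_early alpha_gt0 gamma_gt0 mu_gt0 _ te_eq.
have late := equilibrium_late alpha_gt0 gamma_gt0 mu_gt0 _ te_eq.
have [tte|tet] := leP t te; first by rewrite (early _ _ eqG)// (early _ _ eqF).
(* Past [te] both cdfs solve the same equation, with the same value at [te]. *)
apply: (smooth_cost_inj a_gt0 gamma_gt0 mu_gt0 (s := te)) (ltW tet).
- by move=> u; apply: late eqG _ _ _.
- by move=> u; apply: late eqF _ _ _.
- by rewrite (early _ _ eqG)// (early _ _ eqF).
Qed.
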